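(* Let $\mathcal A$ be a unital Banach algebra, $1\in\mathcal B\subset\mathcal A$ a unital Banach subalgebra, and $E:\mathcal A\to\mathcal B$ a conditional expectation. Let $a_1,a_2\in\mathcal A$ be two random variables that are $\mathcal B$-free with respect to $E$, with $a_1$, $a_2$ and $a_1+a_2$ non-zero. Let $b\in\mathcal B$ be an invertible element of $\mathcal B$ with $$\|b\|<\min\left(\frac{1}{11\|a_1+a_2\|},\frac{1}{11\|a_1\|},\frac{1}{11\|a_2\|}\right).$$ Then the amalgamated $R$-transform satisfies $$R_{a_1+a_2}(b)=R_{a_1}(b)+R_{a_2}(b).$$
   Context: Banach algebras are over $\mathbb C$, with $\|1\|=1$. A conditional expectation $E:\mathcal A\to\mathcal B$ is a linear map with $E(b)=b$ for all $b\in\mathcal B$, which is norm-decreasing ($\|E(a)\|\le\|a\|$), and satisfies $E(b_1ab_2)=b_1E(a)b_2$ for $b_1,b_2\in\mathcal B$, $a\in\mathcal A$. $\mathcal B$-freeness: $a_1,a_2\in\mathcal A$ are $\mathcal B$-free with respect to $E$ if for all $n\in\mathbb N$, all indices $i_1,\dots,i_n\in\{1,2\}$ with $i_1\ne i_2\ne\cdots\ne i_n$ (consecutive indices differ), and all $x_j\in\mathrm{alg}(\mathcal B,a_{i_j})$ (the subalgebra of $\mathcal A$ generated by $\mathcal B$ and $a_{i_j}$) with $E(x_j)=0$ for $j=1,\dots,n$, one has $E(x_1x_2\cdots x_n)=0$. Notation: $\mathcal B(0,\epsilon)=\{b\in\mathcal B:\|b\|<\epsilon\}$, and $\mathcal B(0,\epsilon)_{\mathrm{inv}}$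 is the set of elements of $\mathcal B(0,\epsilon)$ that are invertible in $\mathcal B$. For $a\in\mathcal A$ non-zero, define $g_a:\mathcal B(0,\tfrac1{\|a\|})\to\mathcal B$ by $g_a(b)=bE((1-ab)^{-1})$. The map $g_a$ is injective on $\mathcal B(0,\tfrac{1}{4\|a\|})$, and the image of this ball contains $\mathcal B(0,\tfrac1{11\|a\|})$; $g_a^{\langle-1\rangle}$ denotes the compositional inverse of the restriction of $g_a$ to $\mathcal B(0,\tfrac1{4\|a\|})$. It maps $\mathcal B(0,\tfrac1{11\|a\|})_{\mathrm{inv}}$ into the invertible elements of $\mathcal B$. The amalgamated $R$-transform of $a$ is $$R_a(b)=\left(g_a^{\langle-1\rangle}(b)\right)^{-1}-b^{-1},\qquad b\in\mathcal B(0,\tfrac1{11\|a\|})_{\mathrm{inv}}.$$ *)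

(* Defs.v *)
From HB Require Import structures.
From mathcomp Require Import all_boot all_order all_algebra.
From mathcomp Require Import boolp classical_sets functions reals.
From mathcomp Require Import topology normedtype.
From mathcomp Require Export complex.

Set Implicit Arguments.
Unset Strict Implicit.
Unset Printing Implicit Defensive.

Import Order.TTheory GRing.Theory Num.Theory.
Import numFieldNormedType.Exports.

Local Open Scope classical_set_scope.
Local Open Scope ring_scope.

(* Hierarchy-Builder rejects a structure joining [unitAlgType] and
   [completeNormedModType], so the multiplication is added on top of a Banach
   space, and the algebra structure on [A : banachAlgType K] is derived. *)
HB.mixin Record CompleteNormedModule_isBanachAlgebra (K : numFieldType) A
    & CompleteNormedModule K A := {
  banach_one : A ;
  banach_mul : A -> A -> A ;
  banach_mulA : associative banach_mul ;
  banach_mul1l : left_id banach_one banach_mul ;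
  banach_mul1r : right_id banach_one banach_mul ;
  banach_mulDl : left_distributive banach_mul +%R ;
  banach_mulDr : right_distributive banach_mul +%R ;
  banach_scaleAl : forall (k : K) (x y : A),
    k *: banach_mul x y = banach_mul (k *: x) y ;
  banach_scaleAr : forall (k : K) (x y : A),
    k *: banach_mul x y = banach_mul x (k *: y) ;
  banach_normM : forall x y : A, `|banach_mul x y| <= `|x| * `|y| ;
  banach_norm1 : `|banach_one| = 1
}.

#[short(type="banachAlgType")]
HB.structure Definition BanachAlgebra (K : numFieldType) :=
  {A of CompleteNormedModule K A & CompleteNormedModule_isBanachAlgebra K A}.

Section BanachAlgebraRing.
Context {K : numFieldType} {A : banachAlgType K}.

Fact banach_one_neq0 : banach_one != 0 :> A.
Proof. by rewrite -normr_eq0 banach_norm1 oner_eq0. Qed.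

#[non_forgetful_inheritance]
HB.instance Definition _ := GRing.Zmodule_isNzRing.Build A
  (@banach_mulA K A) (@banach_mul1l K A) (@banach_mul1r K A)
  (@banach_mulDl K A) (@banach_mulDr K A) banach_one_neq0.

#[non_forgetful_inheritance]
HB.instance Definition _ :=
  GRing.Lmodule_isLalgebra.Build K A (@banach_scaleAl K A).

#[non_forgetful_inheritance]
HB.instance Definition _ :=
  GRing.Lalgebra_isAlgebra.Build K A (@banach_scaleAr K A).

Definition banach_is_inverse (x y : A) : Prop := y * x = 1 /\ x * y = 1.

(* Units and inverses are not data of a Banach algebra: they are recovered
   classically from the multiplication. *)
Definition banach_unit : {pred A} :=
  fun x => `[< exists y, banach_is_inverse x y >].

Definition banach_inv (x : A) : A := xget x [set y | banach_is_inverse x y].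

Fact banach_inv_spec x :
  x \in banach_unit -> banach_is_inverse x (banach_inv x).
Proof. by move=> /asboolP[y xy]; rewrite /banach_inv; case: xgetP => [z _|/(_ y)]. Qed.

Fact banach_mulVx : {in banach_unit, left_inverse 1 banach_inv *%R}.
Proof. by move=> x /banach_inv_spec[]. Qed.

Fact banach_mulxV : {in banach_unit, right_inverse 1 banach_inv *%R}.
Proof. by move=> x /banach_inv_spec[]. Qed.

Fact banach_unitP x y : y * x = 1 /\ x * y = 1 -> banach_unit x.
Proof. by move=> xy; apply/asboolP; exists y. Qed.

Fact banach_inv_out : {in [predC banach_unit], banach_inv =1 id}.
Proof.
move=> x; rewrite inE => /asboolPn nx; rewrite /banach_inv.
by case: xgetP => // y _ xy; case: nx; exists y.
Qed.

#[non_forgetful_inheritance]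
HB.instance Definition _ := GRing.NzRing_hasMulInverse.Build A
  banach_mulVx banach_mulxV banach_unitP banach_inv_out.

End BanachAlgebraRing.

Section RTransform.
Context {K : numFieldType} {A : banachAlgType K}.

Definition unital_subalgebra (S : set A) : Prop :=
  GRing.subalg_closed (mem S).

(* A subalgebra is a Banach algebra for the inherited norm iff it is closed. *)
Definition banach_subalgebra (B : set A) : Prop :=
  unital_subalgebra B /\ closed B.

(* A map into B is represented as a map A -> A with values in B. *)
Definition conditional_expectation (B : set A) (E : A -> A) : Prop :=
  [/\ linear E,
      forall a, B (E a),
      forall b, B b -> E b = b,
      forall a, `|E a| <= `|a|
    & forall b1 a b2, B b1 -> B b2 -> E (b1 * a * b2) = b1 * E a * b2].

Definition alg (B : set A) (a : A) : set A :=
  smallest unital_subalgebra (a |` B).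

(* The words are nonempty: the empty product 1 has E 1 = 1. *)
Definition B_free (B : set A) (E : A -> A) (a1 a2 : A) : Prop :=
  forall (n : nat) (i : 'I_n -> bool) (x : 'I_n -> A),
    (0 < n)%N ->
    (forall j k : 'I_n, k = j.+1 :> nat -> i j != i k) ->
    (forall j, alg B (if i j then a1 else a2) (x j)) ->
    (forall j, E (x j) = 0) ->
    E (\prod_(j < n) x j) = 0.

Definition invertible_in (B : set A) (b : A) : Prop :=
  [/\ B b, b \is a GRing.unit & B b^-1].

Definition sub_ball (B : set A) (e : K) : set A :=
  [set b | B b /\ `|b| < e].

Definition g_map (E : A -> A) (a b : A) : A := b * E ((1 - a * b)^-1).

(* Outside the image of the ball under [g_map E a] the value of [pinv_] is
   irrelevant. *)
Definition g_inv (B : set A) (E : A -> A) (a : A) : A -> A :=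
  'pinv_(fun=> 0) (sub_ball B (4 * `|a|)^-1) (g_map E a).

Definition R_transform (B : set A) (E : A -> A) (a b : A) : A :=
  (g_inv B E a b)^-1 - b^-1.

End RTransform.

(* Main.v *)
(* Write g_a^{<-1>}(b) = x, X = (1 - a x)^-1 and d = E X. Then x^-1 = d b^-1, so
   R_a(b) = (d - 1) b^-1, and (x^-1 - a)^-1 = x X = b (1 + u) for
   u = d^-1 X - 1, which satisfies E u = 0 and is small. Taking d_i, u_i for a_i,
   the algebraic identity
     ((d_1 + d_2 - 1) b^-1 - (a_1 + a_2))^-1
       = b (1 + u_2) (1 - u_1 u_2)^-1 (1 + u_1)
   and the Neumann series of (1 - u_1 u_2)^-1 express the resolvent of a_1 + a_2
   as b plus b times alternating words in u_1 and u_2. By freeness E kills these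
   words, so x = b (d_1 + d_2 - 1)^-1 satisfies g_{a_1 + a_2}(x) = b, and
   d_1 + d_2 - 1 is the value of d for a_1 + a_2. *)
Require Import Defs.
From HB Require Import structures.
From mathcomp Require Import all_boot all_order all_algebra.
From mathcomp Require Import boolp classical_sets functions reals.
From mathcomp Require Import topology normedtype.
From mathcomp Require Import sequences ring lra.
Import Order.TTheory GRing.Theory Num.Theory.
Import numFieldNormedType.Exports.
Local Open Scope classical_set_scope.
Local Open Scope ring_scope.

Set Implicit Arguments.
Unset Strict Implicit.
Unset Printing Implicit Defensive.

(** * Analysis in a complex Banach algebra: real-valued norms, contractions, Neumann series *)

Lemma expr_small (R : realType) (C q e : R) :
  0 <= q -> q < 1 -> 0 < e ->
  exists N, forall n, (N <= n)%N -> C * q ^+ n < e.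
Proof.
move=> q0 q1 e0.
have q1' : `|q| < 1 by rewrite ger0_norm.
have /cvgrPdist_lt /(_ e e0) [N _ hN] := cvg_geometric C q1'.
exists N => n Nn; have := hN n Nn.
by rewrite /= sub0r normrN; apply: le_lt_trans; exact: ler_norm.
Qed.

Section RealNorm.
Context {R : realType} {A : banachAlgType R[i]}.
Implicit Types (x y z : A) (P : set A).
Local Open Scope complex_scope.

(* [R[i]] is only partially ordered; with the norm in [R], [lra] applies. *)
Definition rnorm (x : A) : R := complex.Re `|x|.

Lemma rnormE x : `|x| = (rnorm x)%:C.
Proof. by rewrite /rnorm RRe_real// normr_real. Qed.

Lemma rnorm_ge0 x : 0 <= rnorm x.
Proof. by rewrite -lecR -rnormE normr_ge0. Qed.

Lemma rnorm_le x y : (rnorm x <= rnorm y) = (`|x| <= `|y|).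
Proof. by rewrite !rnormE lecR. Qed.

Lemma rnormD x y : rnorm (x + y) <= rnorm x + rnorm y.
Proof. by rewrite -lecR rmorphD/= -!rnormE ler_normD. Qed.

Lemma rnormN x : rnorm (- x) = rnorm x.
Proof. by rewrite /rnorm normrN. Qed.

Lemma rnormB x y : rnorm (x - y) <= rnorm x + rnorm y.
Proof. by rewrite -(rnormN y) rnormD. Qed.

Lemma rnorm_distC x y : rnorm (x - y) = rnorm (y - x).
Proof. by rewrite -rnormN opprB. Qed.

Lemma rnormM x y : rnorm (x * y) <= rnorm x * rnorm y.
Proof. by rewrite -lecR rmorphM/= -!rnormE banach_normM. Qed.

Lemma rnormM_le x y (s t : R) :
  rnorm x <= s -> rnorm y <= t -> rnorm (x * y) <= s * t.
Proof.
by move=> xs yt; apply: le_trans (rnormM x y) _; rewrite ler_pM ?rnorm_ge0.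
Qed.

Lemma rnorm1 : rnorm 1 = 1.
Proof. by rewrite /rnorm banach_norm1. Qed.

Lemma rnorm0 : rnorm 0 = 0.
Proof. by rewrite /rnorm normr0. Qed.

Lemma rnormX x n : rnorm (x ^+ n) <= rnorm x ^+ n.
Proof.
elim: n => [|n ih]; first by rewrite !expr0 rnorm1.
by rewrite !exprS; exact: rnormM_le.
Qed.

Lemma rnorm_eq0 x : rnorm x = 0 -> x = 0.
Proof. by move=> x0; apply/eqP; rewrite -normr_eq0 rnormE x0. Qed.

Lemma rnorm_gt0 x : x != 0 -> 0 < rnorm x.
Proof. by move=> x0; rewrite lt_def rnorm_ge0 andbT;
  apply: contraNneq x0 => /rnorm_eq0 ->. Qed.

Lemma rnorm_small0 x : (forall e, 0 < e -> rnorm x <= e) -> x = 0.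
Proof.
by move=> h; apply: rnorm_eq0; apply/eqP; rewrite eq_le rnorm_ge0 andbT;
  apply/ler_addgt0Pr => e e0; rewrite add0r h.
Qed.

Lemma closureP_rnorm P x :
  closure P x <-> forall e : R, 0 < e -> exists2 y, P y & rnorm (x - y) < e.
Proof.
split=> [Px e e0|Px U].
  have e0' : 0 < e%:C by rewrite ltcR.
  have [y [Py]] := Px _ (nbhsx_ballx x _ e0').
  by rewrite -ball_normE /ball_ /= rnormE ltcR; exists y.
move=> /nbhs_ballP [e /= e0 eU].
have eE : e = (complex.Re e)%:C by rewrite RRe_real// gtr0_real.
have [|y Py yx] := Px (complex.Re e); first by rewrite -ltcR -eE.
by exists y; split => //; apply: eU; rewrite -ball_normE /ball_ /= rnormE eE ltcR.
Qed.

Lemma closedP_rnorm P :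
  (forall x, (forall e : R, 0 < e -> exists2 y, P y & rnorm (x - y) < e) -> P x) ->
  closed P.
Proof. by move=> h x /closureP_rnorm /h. Qed.

Lemma closed_rnorm_le (r : R) : closed [set x | rnorm x <= r].
Proof.
apply: closedP_rnorm => x h /=; apply/ler_addgt0Pr => e e0.
have [y /= yr xy] := h _ e0.
by rewrite -(subrK y x) (le_trans (rnormD _ _))//; lra.
Qed.

(** Completeness enters here. The closed set [P] locates the fixed point as well, which later places
    inverses in [B] or in the closure of [alg B a]. *)
Lemma contraction_fixpoint P (f : A -> A) (q : R) x0 :
  closed P -> P x0 -> (forall x, P x -> P (f x)) -> 0 <= q -> q < 1 ->
  (forall x y, P x -> P y -> rnorm (f x - f y) <= q * rnorm (x - y)) ->
  exists2 x, P x & f x = x.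
Proof.
move=> clP Px0 Pf q0 q1 fq.
pose u n := iter n f x0.
have Pu n : P (u n) by elim: n => //= n; exact: Pf.
pose C := rnorm (u 1%N - u 0%N).
have uS n : rnorm (u n.+1 - u n) <= C * q ^+ n.
  elim: n => [|n ih]; first by rewrite expr0 mulr1.
  apply: le_trans (fq _ _ (Pu n.+1) (Pu n)) _.
  by rewrite exprS mulrCA ler_wpM2l.
(* Geometric sum with the factor [1 - q] cleared, so that the induction telescopes. *)
have um n m :
    rnorm (u (n + m)%N - u n) * (1 - q) <= C * (q ^+ n - q ^+ (n + m)).
  elim: m => [|m ih]; first by rewrite addn0 !subrr rnorm0 mul0r mulr0.
  have := uS (n + m)%N.
  have := rnormD (u (n + m).+1 - u (n + m)%N) (u (n + m)%N - u n).
  rewrite subrKA -addnS => h1 h2.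
  have h3 : rnorm (u (n + m.+1)%N - u n) <=
      C * q ^+ (n + m) + rnorm (u (n + m)%N - u n) by lra.
  have q1' : 0 <= 1 - q by lra.
  have := ler_wpM2r q1' h3; rewrite addnS exprS; lra.
have C0 : 0 <= C by exact: rnorm_ge0.
have uN (e : R) : 0 < e -> exists N, forall n, (N <= n)%N -> rnorm (u n - u N) < e.
  move=> e0; have e0' : 0 < e * (1 - q) by rewrite mulr_gt0// subr_gt0.
  have [N hN] := @expr_small R C q _ q0 q1 e0'; exists N => n Nn.
  have q1' : 0 < 1 - q by lra.
  rewrite -(ltr_pM2r q1') -(subnKC Nn) (le_lt_trans (um _ _))//.
  apply: le_lt_trans (hN N (leqnn _)); rewrite ler_wpM2l//.
  by rewrite lerBlDr lerDl exprn_ge0.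
have cu : cvg (u @ \oo).
  apply/cauchy_cvgP; apply: cauchy_exP => e /= e0.
  have eE : e = (complex.Re e)%:C by rewrite RRe_real// gtr0_real.
  have [|N hN] := uN (complex.Re e); first by rewrite -ltcR -eE.
  exists (u N); exists N => // n /= Nn.
  by rewrite -ball_normE /ball_ /= rnormE eE ltcR rnorm_distC hN.
pose p := lim (u @ \oo).
have Pp : P p by apply: (@closed_cvg _ _ _ _ u P clP _ p cu); exact: nearW.
exists p => //; apply/eqP; rewrite -subr_eq0; apply/eqP/rnorm_small0 => e e0.
(* [f p - p] splits into [f p - f (u N)] and [u N.+1 - p], each smaller than [e / 2]. *)
have e20 : 0 < e / 2 by rewrite divr_gt0.
have e20' : 0 < (e / 2)%:C by rewrite ltcR.
have /cvgrPdist_lt /(_ _ e20') [N _ hN] := cu.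
have h1 := hN N (leqnn _); have h2 := hN N.+1 (leqnSn _).
move: h1 h2; rewrite /= !rnormE !ltcR -/p => h1 h2.
have h3 := fq _ _ Pp (Pu N).
have h4 := rnormD (f p - f (u N)) (f (u N) - p).
rewrite subrKA (rnorm_distC (f (u N)) p) in h4.
have h5 : q * rnorm (p - u N) <= rnorm (p - u N).
  by rewrite ler_piMl ?rnorm_ge0// ltW.
by rewrite -/(u N) in h2; lra.
Qed.

(** The fixed points of [1 + w * x] and [1 + y * w] are a right and a left inverse, and therefore
    coincide. *)
Lemma unitr_1B w : rnorm w < 1 -> 1 - w \is a GRing.unit.
Proof.
move=> w1.
have [x _ fx] : exists2 x, [set: A] x & 1 + w * x = x.
  apply: (@contraction_fixpoint _ _ (rnorm w) 0) => //; first exact: rnorm_ge0.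
  by move=> x y _ _; rewrite (addrC 1) addrKA -mulrBr rnormM.
have [y _ fy] : exists2 y, [set: A] y & 1 + y * w = y.
  apply: (@contraction_fixpoint _ _ (rnorm w) 0) => //; first exact: rnorm_ge0.
  by move=> x' y _ _; rewrite (addrC 1) addrKA -mulrBl [leRHS]mulrC rnormM.
have xE : (1 - w) * x = 1 by rewrite mulrBl mul1r -{1}fx addrK.
have yE : y * (1 - w) = 1 by rewrite mulrBr mulr1 -{1}fy addrK.
have xy : y = x by rewrite -[y]mulr1 -xE mulrA yE mul1r.
by apply/unitrP; exists x; rewrite xE -{1}xy.
Qed.

(** Iterating [1 + w * x] from [1] produces the partial sums of the Neumann series, all of them in
    [P]. *)
Lemma mem_inv_1B P w : closed P -> P 1 ->
    (forall x, P x -> P (1 + w * x)) -> rnorm w < 1 ->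
  P (1 - w)^-1.
Proof.
move=> clP P1 Pw w1.
have [x Px fx] : exists2 x, P x & 1 + w * x = x.
  apply: (@contraction_fixpoint _ _ (rnorm w) 1) => //; first exact: rnorm_ge0.
  by move=> x y _ _; rewrite (addrC 1) addrKA -mulrBr rnormM.
have xE : (1 - w) * x = 1 by rewrite mulrBl mul1r -{1}fx addrK.
by have <- : x = (1 - w)^-1 by apply: (mulrI (unitr_1B w1)); rewrite divrr ?unitr_1B.
Qed.

Lemma inv_1BE w : rnorm w < 1 -> (1 - w)^-1 = 1 + w * (1 - w)^-1.
Proof.
move=> w1; apply: (mulrI (unitr_1B w1)).
rewrite divrr ?unitr_1B// mulrDr mulr1 mulrA.
have -> : (1 - w) * w = w * (1 - w) by rewrite mulrBl mulrBr mul1r mulr1.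
by rewrite mulrK ?unitr_1B// subrK.
Qed.

Lemma rnorm_inv_1B w q : rnorm w <= q -> q < 1 ->
  rnorm (1 - w)^-1 <= (1 - q)^-1.
Proof.
move=> wq q1; have w1 := le_lt_trans wq q1.
have q1' : 0 < 1 - q by lra.
rewrite -[leRHS]mul1r ler_pdivlMr//.
have := rnormD 1 (w * (1 - w)^-1); rewrite -inv_1BE// rnorm1 => h.
have := rnormM_le wq (lexx (rnorm (1 - w)^-1)); nra.
Qed.

Lemma rnorm_inv_1B_sub1 w q : rnorm w <= q -> q < 1 ->
  rnorm ((1 - w)^-1 - 1) <= q / (1 - q).
Proof.
move=> wq q1; rewrite inv_1BE ?(le_lt_trans wq)// addrC addKr.
by apply: rnormM_le wq (rnorm_inv_1B wq q1).
Qed.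
End RealNorm.

(** * Unital subalgebras, generated subalgebras and closures *)

Section Subalgebra.
Context {K : numFieldType} {A : banachAlgType K}.
Implicit Types (x y a : A) (S : set A).

Lemma unital_subalgebraP S : unital_subalgebra S <->
  [/\ S 1, forall (k : K) x y, S x -> S y -> S (k *: x + y)
    & forall x y, S x -> S y -> S (x * y)].
Proof.
split=> [[S1 SD SM]|[S1 SD SM]]; split.
- by move: S1; rewrite inE.
- by move=> k x y Sx Sy; have := SD k x y; rewrite !inE; apply.
- by move=> x y Sx Sy; have := SM x y; rewrite !inE; apply.
- by rewrite inE.
- by move=> k x y; rewrite !inE; exact: SD.
- by move=> x y; rewrite !inE; exact: SM.
Qed.

Lemma subalg1 S : unital_subalgebra S -> S 1.
Proof. by case/unital_subalgebraP. Qed.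

Lemma subalgM S x y : unital_subalgebra S -> S x -> S y -> S (x * y).
Proof. by case/unital_subalgebraP => _ _; apply. Qed.

Lemma subalgD S x y : unital_subalgebra S -> S x -> S y -> S (x + y).
Proof. by case/unital_subalgebraP => _ h _ Sx Sy; rewrite -[x]scale1r; exact: h. Qed.

Lemma subalgB S x y : unital_subalgebra S -> S x -> S y -> S (x - y).
Proof.
by case/unital_subalgebraP => _ h _ Sx Sy; rewrite addrC -scaleN1r; exact: h.
Qed.

Lemma subalg0 S : unital_subalgebra S -> S 0.
Proof. by move=> hS; rewrite -(subrr 1); apply: subalgB => //; exact: subalg1. Qed.

Lemma alg_subalgebra S a : unital_subalgebra (alg S a).
Proof.
apply/unital_subalgebraP; split=> [T [hT _]|k x y Tx Ty T hT|x y Tx Ty T hT].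
- exact: subalg1.
- have [_ h _] := (unital_subalgebraP _).1 hT.1.
  by apply: h; [exact: Tx|exact: Ty].
- by apply: subalgM; [exact: hT.1|exact: Tx|exact: Ty].
Qed.

Lemma mem_alg S a : alg S a a.
Proof. by move=> T [_]; apply; left. Qed.

Lemma sub_alg S a : S `<=` alg S a.
Proof. by move=> x Sx T [_]; apply; right. Qed.

End Subalgebra.

Section ClosureSubalgebra.
Context {R : realType} {A : banachAlgType R[i]}.
Implicit Types (x y z : A) (S : set A).

(** Left multiplication by [y] is Lipschitz. The affine form matches the Neumann iteration. *)
Lemma closure_subalg_affine S x y z : unital_subalgebra S ->
  S x -> S y -> closure S z -> closure S (x + y * z).
Proof.
move=> hS Sx Sy /closureP_rnorm Sz; apply/closureP_rnorm => e e0.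
have y0 := rnorm_ge0 y; have y1 : 0 < rnorm y + 1 by lra.
(* The summand [1] keeps the denominator positive when [y = 0]. *)
have [|t St zt] := Sz (e / (rnorm y + 1)); first by rewrite divr_gt0.
exists (x + y * t); first by apply: subalgD => //; exact: subalgM.
rewrite (addrC x) addrKA -mulrBr (le_lt_trans (rnormM _ _))//.
rewrite ltr_pdivlMr// in zt; have := rnorm_ge0 (z - t); nra.
Qed.

End ClosureSubalgebra.

(** * Conditional expectations and the local inversion of [g_map] *)

Section ConditionalExpectation.
Context {R : realType} {A : banachAlgType R[i]} (B : set A) (E : A -> A).
Hypotheses (hB : banach_subalgebra B) (hE : conditional_expectation B E).
Implicit Types (x y a b u w : A).

Lemma condexpD x y : E (x + y) = E x + E y.
Proof. by case: hE => + _ _ _ _ => /(_ 1 x y); rewrite !scale1r. Qed.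

Lemma condexpB x y : E (x - y) = E x - E y.
Proof. by apply/eqP; rewrite eq_sym subr_eq -condexpD subrK. Qed.

Lemma condexp1 : E 1 = 1.
Proof. by case: hE => _ _ h _ _; apply: h; apply: subalg1; exact: hB.1. Qed.

Lemma condexp_in x : B (E x).
Proof. by case: hE. Qed.

Lemma condexpMl b x : B b -> E (b * x) = b * E x.
Proof.
case: hE => _ _ _ _ h Bb; have := h b x 1 Bb (subalg1 hB.1).
by rewrite !mulr1.
Qed.

Lemma rnorm_condexp x : rnorm (E x) <= rnorm x.
Proof. by rewrite rnorm_le; case: hE. Qed.

Lemma rnorm_condexp_inv_1B w q : rnorm w <= q -> q < 1 ->
  rnorm (E (1 - w)^-1 - 1) <= q / (1 - q).
Proof.
move=> wq q1; rewrite -[X in _ - X]condexp1 -condexpB.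
exact: le_trans (rnorm_condexp _) (rnorm_inv_1B_sub1 wq q1).
Qed.

(* The map x - g x has Lipschitz constant 1/3 + 1/4 (4/3)^2 = 7/9. *)
Lemma g_map_contraction a x y :
    rnorm a * rnorm x <= 4^-1 -> rnorm a * rnorm y <= 4^-1 ->
  rnorm ((x - g_map E a x) - (y - g_map E a y)) <= 7 / 9 * rnorm (x - y).
Proof.
move=> ax ay.
have hax : rnorm (a * x) <= 4^-1 by exact: le_trans (rnormM _ _) ax.
have hay : rnorm (a * y) <= 4^-1 by exact: le_trans (rnormM _ _) ay.
have q1 : 4^-1 < 1 :> R by lra.
have q34 : (1 - 4^-1)^-1 = 4 / 3 :> R by field.
have Ux := unitr_1B (le_lt_trans hax q1).
have Uy := unitr_1B (le_lt_trans hay q1).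
have nx := rnorm_inv_1B hax q1; have ny := rnorm_inv_1B hay q1.
have ex := rnorm_condexp_inv_1B hax q1.
rewrite /g_map; move: nx ny ex; rewrite q34.
set X := (1 - a * x)^-1; set Y := (1 - a * y)^-1 => nx ny ex.
(* Resolvent identity. *)
have XY : X - Y = X * (a * (x - y)) * Y.
  have -> : a * (x - y) = (1 - a * y) - (1 - a * x).
    by rewrite opprB mulrBr (addrC (1 - _)) subrKA.
  by rewrite mulrBr mulrBl mulVr// mul1r mulrK.
have -> : x - x * E X - (y - y * E Y) =
    - ((x - y) * (E X - 1)) - y * E (X - Y).
  rewrite condexpB !mulrBr !mulrBl !mulr1 !opprD !opprK !addrA.
  by rewrite [RHS](ACl (3*1*4*6*(2*5)))/= subrr addr0.
apply: le_trans (rnormB _ _) _; rewrite rnormN.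
have h1 := rnormM_le (lexx (rnorm (x - y))) ex.
have h2 : rnorm (y * E (X - Y)) <=
    rnorm y * ((4 / 3 * (rnorm a * rnorm (x - y))) * (4 / 3)).
  apply: rnormM_le => //; apply: le_trans (rnorm_condexp _) _.
  by rewrite XY; apply: rnormM_le => //; apply: rnormM_le => //; exact: rnormM.
have h3 := ler_wpM2r (rnorm_ge0 (x - y)) ay.
lra.
Qed.

Lemma g_map_inj a x y :
    rnorm a * rnorm x < 4^-1 -> rnorm a * rnorm y < 4^-1 ->
  g_map E a x = g_map E a y -> x = y.
Proof.
move=> ax ay gxy; have := g_map_contraction (ltW ax) (ltW ay).
rewrite gxy opprB subrKA => h; apply/eqP; rewrite -subr_eq0; apply/eqP.
by apply: rnorm_eq0; have := rnorm_ge0 (x - y); lra.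
Qed.

Lemma g_map_in a x : B x -> B (g_map E a x).
Proof. by move=> Bx; apply: (subalgM hB.1) => //; exact: condexp_in. Qed.

(** Solutions are the fixed points of [x - g_map E a x + b]. The radius 1/9, smaller than 1/4,
    yields the bound 1/8 on [d - 1] needed later. *)
Lemma g_map_surj a b : a != 0 -> B b -> rnorm a * rnorm b < 11^-1 ->
  exists2 x, B x /\ rnorm a * rnorm x <= 9^-1 & g_map E a x = b.
Proof.
move=> /rnorm_gt0 a0 Bb ab.
have rE x : (rnorm x <= 9^-1 / rnorm a) = (rnorm a * rnorm x <= 9^-1).
  by rewrite ler_pdivlMr// (mulrC (rnorm x)).
have [||||||x [Bx xr] fx] := @contraction_fixpoint _ _
  (B `&` [set x | rnorm x <= 9^-1 / rnorm a])
  (fun x => x - g_map E a x + b) (7 / 9) 0.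
- by apply: closedI; [exact: hB.2|exact: closed_rnorm_le].
- split; first exact: subalg0 hB.1.
  by rewrite /= rE rnorm0 mulr0; lra.
- move=> x [Bx /=]; rewrite !rE => xr; split.
    apply: (subalgD hB.1) => //; apply: (subalgB hB.1) => //.
    exact: g_map_in.
  rewrite /= ?rE.
  have hax : rnorm (a * x) <= 9^-1 by exact: le_trans (rnormM _ _) xr.
  have q1 : 9^-1 < 1 :> R by lra.
  have := rnorm_condexp_inv_1B hax q1.
  (* The ball is preserved because 1/9 * 1/8 + 1/11 < 1/9. *)
  have -> : 9^-1 / (1 - 9^-1) = 8^-1 :> R by field.
  move=> ex; have h := rnormM_le (lexx (rnorm x)) ex.
  have -> : x - g_map E a x = - (x * (E (1 - a * x)^-1 - 1)).
    by rewrite mulrBr mulr1 opprB.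
  have h2 : rnorm (- (x * (E (1 - a * x)^-1 - 1)) + b) <=
      rnorm x * 8^-1 + rnorm b.
    by apply: le_trans (rnormD _ _) _; rewrite rnormN lerD2r.
  have := ler_wpM2l (ltW a0) h2; lra.
- by lra.
- by lra.
- move=> x y [_ /=]; rewrite rE => xr [_ /=]; rewrite rE => yr.
  by rewrite (addrC (y - _)) addrKA; apply: g_map_contraction; lra.
exists x; first by split=> //; rewrite -rE.
move: fx; rewrite -addrA -[RHS]addr0 => /addrI /eqP.
by rewrite addrC subr_eq0 => /eqP.
Qed.

(** The Neumann series in [1 - d] stays in [B], a closed subalgebra. *)
Lemma unitr_near1_in d : B d -> rnorm (d - 1) < 1 ->
  d \is a GRing.unit /\ B d^-1.
Proof.
move=> Bd d1; have dE : d = 1 - (1 - d) by rewrite subKr.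
have d1' : rnorm (1 - d) < 1 by rewrite rnorm_distC.
rewrite dE; split; first exact: unitr_1B.
apply: mem_inv_1B d1' => [||x Bx]; [exact: hB.2|exact: subalg1 hB.1|].
apply: (subalgD hB.1); first exact: subalg1 hB.1.
apply: (subalgM hB.1) => //; apply: (subalgB hB.1) => //; exact: subalg1 hB.1.
Qed.

(** With [X = (1 - a * x)^-1], take [d = E X] and [u = d^-1 * X - 1]. Membership of [u] holds only
    in a closure, since [X] is an infinite series. *)
Lemma g_map_resolvent a b x : invertible_in B b -> B x ->
    rnorm a * rnorm x <= 9^-1 -> g_map E a x = b ->
  exists d u, [/\ B d, rnorm (d - 1) <= 8^-1, x = b * d^-1, E u = 0 &
    [/\ rnorm u <= 2 / 7, closure (alg B a) u &
     (d * b^-1 - a) * (b * (1 + u)) = 1]].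
Proof.
move=> [Bb Ub Bb'] Bx ax gx.
have hax : rnorm (a * x) <= 9^-1 by exact: le_trans (rnormM _ _) ax.
have q1 : 9^-1 < 1 :> R by lra.
have ax1 : rnorm (a * x) < 1 by exact: le_lt_trans q1.
have := rnorm_condexp_inv_1B hax q1; have := rnorm_inv_1B_sub1 hax q1.
have UX := unitr_1B ax1.
have -> : 9^-1 / (1 - 9^-1) = 8^-1 :> R by field.
move: gx; rewrite /g_map; set X := (1 - a * x)^-1; set d := E X => gx X1 d1.
have [|Ud Bd'] := unitr_near1_in (condexp_in X); first by lra.
rewrite -/d in Ud Bd'.
have xE : x = b * d^-1 by rewrite -gx mulrK.
exists d, (d^-1 * X - 1); split=> //.
- exact: condexp_in.
- by rewrite condexpB condexpMl// mulVr// condexp1 subrr.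
split.
- have d1' : rnorm (1 - d) <= 8^-1 by rewrite rnorm_distC.
  have q8 : 8^-1 < 1 :> R by lra.
  have := rnorm_inv_1B d1' q8; rewrite subKr.
  have -> : (1 - 8^-1)^-1 = 8 / 7 :> R by field.
  move=> d'.
  (* This gives the bound 8/7 * (1/8 + 1/8) = 2/7. *)
  have -> : d^-1 * X - 1 = d^-1 * ((X - 1) - (d - 1)).
    by rewrite opprB subrKA mulrBr mulVr.
  apply: le_trans (rnormM_le d' (le_trans (rnormB _ _) (lerD X1 d1))) _.
  lra.
- rewrite addrC; apply: closure_subalg_affine; first exact: alg_subalgebra.
  + rewrite -sub0r; apply: (subalgB (alg_subalgebra _ _)).
      exact: subalg0 (alg_subalgebra _ _).
    exact: subalg1 (alg_subalgebra _ _).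
  + exact: sub_alg.
  + apply: mem_inv_1B => //; first exact: closed_closure.
      apply: subset_closure; exact: subalg1 (alg_subalgebra _ _).
    move=> y; apply: closure_subalg_affine; first exact: alg_subalgebra.
      exact: subalg1 (alg_subalgebra _ _).
    apply: (subalgM (alg_subalgebra _ _)); first exact: mem_alg.
    exact: sub_alg.
(* Here [b * (1 + u) = x * X], while [(d * b^-1 - a) * x = 1 - a * x]. *)
- rewrite (addrC 1) subrK (mulrA b) -xE mulrA mulrBl.
  rewrite [Z in Z - _](_ : _ = 1) ?mulrV//.
  by rewrite xE mulrA mulrVK// divrr.
Qed.

(** Centring an approximant [y] to [y - E y] at most doubles its error, because [E u = 0] and [E] is
    norm-decreasing. *)
Lemma closure_condexp0_approx S u (e : R) :
    unital_subalgebra S -> B `<=` S -> closure S u -> E u = 0 -> 0 < e ->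
  exists v, [/\ S v, E v = 0 & rnorm (u - v) <= e].
Proof.
move=> hS BS /closureP_rnorm Su Eu e0.
have [|y Sy uy] := Su (e / 2); first by rewrite divr_gt0.
exists (y - E y); split.
- by apply: subalgB => //; apply: BS; exact: condexp_in.
- have EE : E (E y) = E y by case: hE => _ _ h _ _; apply: h; exact: condexp_in.
  by rewrite condexpB EE subrr.
- have -> : u - (y - E y) = (u - y) - E (u - y).
    by rewrite condexpB Eu sub0r opprK opprB addrA addrAC.
  by have := rnormB (u - y) (E (u - y)); have := rnorm_condexp (u - y); lra.
Qed.

End ConditionalExpectation.

(** * Alternating words in two letters and their norms *)

Section AlternatingProduct.
Context {T : pzRingType}.
Implicit Types (u v : bool -> T).

(** The xor with the parity of the position gives the words the shape required by [B_free]; [c]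
    selects the first letter. *)
Definition altprod u (c : bool) n := \prod_(j < n) u (c (+) odd j).

Lemma altprod0 u c : altprod u c 0 = 1.
Proof. by rewrite /altprod big_ord0. Qed.

Lemma altprodS u c n : altprod u c n.+1 = u c * altprod u (~~ c) n.
Proof.
rewrite /altprod big_ord_recl /= addbF; congr (_ * _).
by apply: eq_bigr => j _; rewrite /= addbN addNb.
Qed.

Lemma altprod_double u k : (u true * u false) ^+ k = altprod u true k.*2.
Proof.
elim: k => [|k ih]; first by rewrite altprod0.
by rewrite doubleS !altprodS /= -ih exprS mulrA.
Qed.

Lemma altprod_doubleS u k :
  (u true * u false) ^+ k * u true = altprod u true k.*2.+1.
Proof.
elim: k => [|k ih]; first by rewrite altprodS altprod0 mulr1 mul1r.
by rewrite doubleS 2!altprodS /= -ih exprS !mulrA.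
Qed.

End AlternatingProduct.

Section AlternatingProductNorm.
Context {R : realType} {A : banachAlgType R[i]}.
Implicit Types (u v : bool -> A).

Lemma rnorm_altprod_le1 u c n :
  (forall d, rnorm (u d) <= 1) -> rnorm (altprod u c n) <= 1.
Proof.
move=> u1; elim: n c => [|n ih] c; first by rewrite altprod0 rnorm1.
by rewrite altprodS -[leRHS]mulr1; exact: rnormM_le.
Qed.

(** Letters are replaced one at a time; the remaining factors have norm at most 1, so each
    replacement costs at most [e]. *)
Lemma rnorm_altprodB u v (e : R) c n :
    (forall d, rnorm (u d) <= 1) -> (forall d, rnorm (v d) <= 1) ->
    (forall d, rnorm (u d - v d) <= e) ->
  rnorm (altprod u c n - altprod v c n) <= n%:R * e.
Proof.
move=> u1 v1 uv; elim: n c => [|n ih] c.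
  by rewrite !altprod0 subrr rnorm0 mul0r.
have -> : altprod u c n.+1 - altprod v c n.+1 =
    u c * (altprod u (~~ c) n - altprod v (~~ c) n)
    + (u c - v c) * altprod v (~~ c) n.
  by rewrite !altprodS mulrBr mulrBl subrKA.
have h1 := rnormM_le (u1 c) (ih (~~ c)).
have h2 := rnormM_le (uv c) (rnorm_altprod_le1 (~~ c) n v1).
by apply: le_trans (rnormD _ _) _; rewrite -natr1; lra.
Qed.

End AlternatingProductNorm.

(** * Freeness extended to closures, and the expectation of the free resolvent *)

Section Freeness.
Context {R : realType} {A : banachAlgType R[i]} (B : set A) (E : A -> A).
Context (a1 a2 : A).
Hypotheses (hB : banach_subalgebra B) (hE : conditional_expectation B E).
Hypothesis hfree : B_free B E a1 a2.
Variable u : bool -> A.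
Hypothesis u_lt1 : forall c, rnorm (u c) < 1.
Hypothesis u_closure : forall c, closure (alg B (if c then a1 else a2)) (u c).
Hypothesis Eu0 : forall c, E (u c) = 0.

(* B-freeness only concerns the algebras generated by B and a_i, whereas
   resolvents lie in their closures. *)
Lemma condexp_altprod c n : (0 < n)%N -> E (altprod u c n) = 0.
Proof.
move=> n0; apply: rnorm_small0 => e e0.
(* The first two bounds keep the approximating letters in the unit ball; the last keeps the total
   error of [n] replacements below [e]. *)
pose r := Num.min (Num.min (1 - rnorm (u true)) (1 - rnorm (u false))) (e / n%:R).
have n0' : 0 < n%:R :> R by rewrite ltr0n.
have r0 : 0 < r by rewrite !lt_min !subr_gt0 !u_lt1 divr_gt0.
have ur d : r + rnorm (u d) <= 1.
  have : r <= 1 - rnorm (u d) by rewrite /r; case: d; rewrite !ge_min lexx ?orbT.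
  lra.
have re : n%:R * r <= e.
  by rewrite mulrC -ler_pdivlMr// ge_min lexx orbT.
have approx d : exists v, [/\ alg B (if d then a1 else a2) v, E v = 0,
    rnorm v <= 1 & rnorm (u d - v) <= r].
  have [v [Sv Ev uv]] := closure_condexp0_approx hE (alg_subalgebra _ _)
    (@sub_alg _ _ _ _) (@u_closure d) (Eu0 d) r0.
  exists v; split=> //; have := rnormD (v - u d) (u d).
  by rewrite subrK rnorm_distC; have := ur d; lra.
have [v hv] := choice approx.
have v0 : E (altprod v c n) = 0.
  apply: (@hfree n (fun j => c (+) odd j) (fun j => v (c (+) odd j))) => //.
  - by move=> j k /= ->; rewrite /= addbN; case: (_ (+) _).
  - by move=> j; case: (hv (c (+) odd j)).
  - by move=> j; case: (hv (c (+) odd j)).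
rewrite -[E _]subr0 -v0 -(condexpB hE) (le_trans (rnorm_condexp hE _))//.
apply: le_trans re; apply: rnorm_altprodB => d; last by case: (hv d).
  exact: ltW.
by case: (hv d).
Qed.

(** Only the empty word survives [E]. A finite expansion with an explicit remainder replaces the
    infinite Neumann series. *)
Lemma condexp_free_resolvent :
  E ((1 + u false) * (1 - u true * u false)^-1 * (1 + u true)) = 1.
Proof.
pose w := u true * u false.
have w1 : rnorm w < 1.
  by have := rnormM (u true) (u false); have := u_lt1 true;
    have := u_lt1 false; have := rnorm_ge0 (u true);
    have := rnorm_ge0 (u false); rewrite -/w; nra.
pose Q x := E ((1 + u false) * x * (1 + u true)).
have QD x y : Q (x + y) = Q x + Q y.
  by rewrite /Q (mulrDr (1 + u false)) mulrDl (condexpD hE).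
(* Besides [w ^+ k], the expansion has words of lengths 2k+1, 2k+1 and 2k+2, nonempty even for
   [k = 0]. *)
have Qw k : Q (w ^+ k) = E (w ^+ k).
  rewrite /Q; have -> : (1 + u false) * w ^+ k * (1 + u true) = w ^+ k
      + altprod u false k.*2.+1 + altprod u true k.*2.+1
      + altprod u false k.*2.+2.
    rewrite !(altprodS u false) /= -altprod_double -altprod_doubleS -/w.
    by rewrite mulrDl mul1r mulrDr mulr1 mulrDl mulrA addrA.
  by rewrite !(condexpD hE) !condexp_altprod// !addr0.
(* [T k] is the tail of the Neumann series from degree [k]. [Q] takes the same value on every tail
   with [k] positive, and these values tend to 0. *)
pose T k := w ^+ k * (1 - w)^-1.
have TS k : T k = w ^+ k + T k.+1.
  by rewrite /T {1}inv_1BE// mulrDr mulr1 mulrA -exprSr.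
have QT0 : Q (T 0%N) = 1 + Q (T 1%N).
  by rewrite TS QD Qw expr0 (condexp1 hB hE).
have QTS k : Q (T 1%N) = Q (T k.+1).
  elim: k => // k ->; rewrite TS QD Qw altprod_double condexp_altprod ?add0r//.
have QT1 : Q (T 1%N) = 0.
  apply: rnorm_small0 => e e0.
  pose C := rnorm (1 + u false) * rnorm (1 - w)^-1 * rnorm (1 + u true).
  have [N hN] := expr_small C (rnorm_ge0 w) w1 e0.
  rewrite (QTS N) (le_trans (rnorm_condexp hE _))//.
  apply: le_trans (ltW (hN N.+1 (leqnSn _))).
  rewrite (_ : C * _ = rnorm (1 + u false) * (rnorm w ^+ N.+1
    * rnorm (1 - w)^-1) * rnorm (1 + u true)); last by rewrite /C; ring.
  by do 3?[apply: rnormM_le => //]; exact: rnormX.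
by rewrite -[RHS]addr0 -QT1 -QT0 /Q /T expr0 mul1r.
Qed.

End Freeness.

(** * The compositional inverse and evaluation of the [R]-transform *)

Section GInverse.
Context {R : realType} {A : banachAlgType R[i]} (B : set A) (E : A -> A).
Hypotheses (hB : banach_subalgebra B) (hE : conditional_expectation B E).
Implicit Types (a b d x : A).
Local Open Scope complex_scope.

Lemma norm_lt_invM a x n : a != 0 -> (0 < n)%N ->
  (`|x| < (n%:R * `|a|)^-1) = (rnorm a * rnorm x < n%:R^-1).
Proof.
move=> /rnorm_gt0 a0 n0.
have -> : (n%:R * `|a|)^-1 = ((n%:R * rnorm a)^-1)%:C.
  by rewrite rnormE fmorphV rmorphM/= rmorph_nat.
by rewrite rnormE ltcR invfM ltr_pdivlMr// mulrC.
Qed.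

Lemma g_inv_map a x : a != 0 -> B x -> rnorm a * rnorm x < 4^-1 ->
  g_inv B E a (g_map E a x) = x.
Proof.
move=> a0 Bx ax; apply: pinvKV => [y z|].
  rewrite !inE => -[_]; rewrite norm_lt_invM// => ay [_].
  by rewrite norm_lt_invM// => az; exact: (g_map_inj hB hE).
by rewrite inE; split=> //; rewrite norm_lt_invM.
Qed.

(** Injectivity on the ball of radius [(4 * |a|)^-1] identifies any preimage of [b] found there with
    [g_inv B E a b]. *)
Lemma R_transformE a b d : a != 0 -> B (b * d^-1) ->
    b \is a GRing.unit -> d \is a GRing.unit ->
    rnorm a * rnorm (b * d^-1) < 4^-1 -> g_map E a (b * d^-1) = b ->
  R_transform B E a b = d * b^-1 - b^-1.
Proof.
move=> a0 Bx Ub Ud ax gx; rewrite /R_transform -{1}gx g_inv_map//.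
by rewrite invrM ?unitrV// invrK.
Qed.

End GInverse.

(** * Additivity, by exhibiting the preimage of [b] for the sum *)

Theorem theorem2p5 (R : realType) (A : banachAlgType R[i]) (B : set A)
    (E : A -> A) (a1 a2 b : A)
    (hB : banach_subalgebra B)
    (hE : conditional_expectation B E)
    (hfree : B_free B E a1 a2)
    (ha1 : a1 != 0) (ha2 : a2 != 0) (ha12 : a1 + a2 != 0)
    (hb : invertible_in B b)
    (hnorm : `|b| < Num.min (11 * `|a1 + a2|)^-1
                      (Num.min (11 * `|a1|)^-1 (11 * `|a2|)^-1)) :
  R_transform B E (a1 + a2) b = R_transform B E a1 b + R_transform B E a2 b.
Proof.
have [Bb Ub Bb'] := hb.
have real11 x : (11 * `|x|)^-1 \is Num.real.
  by rewrite realV; apply: realM; [exact: realn|exact: normr_real].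
(* [R[i]] is only partially ordered, so splitting a minimum needs comparable, here real,
   arguments. *)
have hmin x y z : y \is Num.real -> z \is Num.real ->
    x < Num.min y z -> x < y /\ x < z :> R[i].
  move=> ry rz; rewrite /Num.min; case: (real_ltP ry rz) => yz xy.
    by split=> //; exact: lt_trans yz.
  by split=> //; exact: lt_le_trans yz.
have [||h12 h'] := hmin _ _ _ _ _ hnorm.
- exact: real11.
- by rewrite /Num.min; case: ifP => _; exact: real11.
have [||h1 h2] := hmin _ _ _ _ _ h'; [exact: real11|exact: real11|].
rewrite !norm_lt_invM// in h12 h1 h2.
have [x1 [Bx1 ax1] gx1] := g_map_surj hB hE ha1 Bb h1.
have [x2 [Bx2 ax2] gx2] := g_map_surj hB hE ha2 Bb h2.
have [d1 [u1 [Bd1 nd1 x1E Eu1 [nu1 cu1 ru1]]]] :=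
  g_map_resolvent hB hE hb Bx1 ax1 gx1.
have [d2 [u2 [Bd2 nd2 x2E Eu2 [nu2 cu2 ru2]]]] :=
  g_map_resolvent hB hE hb Bx2 ax2 gx2.
have [|Ud1 Bd1'] := unitr_near1_in hB Bd1; first by lra.
have [|Ud2 Bd2'] := unitr_near1_in hB Bd2; first by lra.
(* Since [R_transform] takes the form [(d - 1) * b^-1], additivity dictates this candidate. *)
pose d := d1 + d2 - 1.
have Bd : B d.
  by apply: (subalgB hB.1); [exact: (subalgD hB.1)|exact: subalg1 hB.1].
have dE : d - 1 = (d1 - 1) + (d2 - 1) by rewrite /d -!addrA [- 1 + (_ + _)]addrCA.
have nd : rnorm (d - 1) <= 4^-1.
  by rewrite dE; apply: le_trans (rnormD _ _) _; lra.
have [|Ud Bd'] := unitr_near1_in hB Bd; first by lra.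
pose x := b * d^-1.
have Bx : B x by exact: (subalgM hB.1).
(* [d^-1] has norm at most 4/3, and 4/3 * 1/11 < 1/4. *)
have ax : rnorm (a1 + a2) * rnorm x < 4^-1.
  have nd' : rnorm (1 - d) <= 4^-1 by rewrite rnorm_distC.
  have q4 : 4^-1 < 1 :> R by lra.
  have := rnorm_inv_1B nd' q4; rewrite subKr.
  have -> : (1 - 4^-1)^-1 = 4 / 3 :> R by field.
  move=> /(rnormM_le (lexx (rnorm b)))/(ler_wpM2l (rnorm_ge0 (a1 + a2))).
  by rewrite -/x mulrA; lra.
pose Y := (1 + u2) * (1 - u1 * u2)^-1 * (1 + u1).
have EY : E Y = 1.
  by apply: (condexp_free_resolvent hB hE hfree
                                    (u := fun c => if c then u1 else u2));
    case=> //; lra.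
have Uw : 1 - u1 * u2 \is a GRing.unit.
  apply: unitr_1B; apply: le_lt_trans (rnormM_le nu1 nu2) _; lra.
have resolvent : (d * b^-1 - (a1 + a2)) * (b * Y) = 1.
  pose c1 := d1 * b^-1 - a1; pose c2 := d2 * b^-1 - a2.
  have -> : d * b^-1 - (a1 + a2) = c1 + (c2 - b^-1).
    rewrite /c1 /c2 /d mulrBl mulrDl mul1r opprD addrA.
    by rewrite !addrA [LHS](ACl (1*4*2*5*3))/=.
  (* By [ru2] the left side is [c1 * b * (1 + u2) - u2]. Writing the last [u2] as
     [c1 * b * (1 + u1) * u2], by [ru1], cancels the terms linear in [u2]. *)
  have key : (c1 + (c2 - b^-1)) * (b * (1 + u2)) = c1 * b * (1 - u1 * u2).
    rewrite mulrDl (mulrBl _ c2) ru2 mulKr// opprD (addrA 1) subrr sub0r.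
    have t1 : c1 * b + c1 * b * u1 = 1 by rewrite -[RHS]ru1 mulrA mulrDr mulr1.
    have -> : - u2 = - (c1 * b * u2 + c1 * b * u1 * u2).
      by rewrite -mulrDl t1 mul1r.
    by rewrite !mulrA mulrDr mulr1 opprD addrA addrK mulrBr mulr1 mulrA.
  by rewrite /Y !mulrA -(mulrA _ b) key mulrK// -mulrA.
have Uax : 1 - (a1 + a2) * x \is a GRing.unit.
  by apply: unitr_1B; apply: le_lt_trans (rnormM _ _) _; lra.
have gx : g_map E (a1 + a2) x = b.
  have -> : b = x * (d * b^-1 * b) by rewrite mulrVK// /x mulrVK.
  rewrite /g_map; congr (_ * _).
  (* A right inverse suffices because [1 - (a1 + a2) * x] is already a unit. Then [E] sends the
     right side, [d * Y], to [d]. *)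
  have -> : (1 - (a1 + a2) * x)^-1 = d * b^-1 * (b * Y).
    apply: (mulrI Uax); rewrite divrr// mulrA mulrBl mul1r.
    have -> : (a1 + a2) * x * (d / b) = a1 + a2.
      by rewrite /x !mulrA mulrVK// mulrK.
    by rewrite resolvent.
  by rewrite mulrA mulrVK// (condexpMl hB hE)// EY mulr1.
rewrite (R_transformE (d := d) hB hE)//.
rewrite (R_transformE (a := a1) (d := d1) hB hE) -?x1E//; last by lra.
rewrite (R_transformE (a := a2) (d := d2) hB hE) -?x2E//; last by lra.
have B1 e : e * b^-1 - b^-1 = (e - 1) * b^-1 by rewrite mulrBl mul1r.
by rewrite !B1 dE mulrDl.
Qed.
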